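(* Let $(X,\Vert\cdot\vert)$ be an asymmetric normed space and let $K\subset X$ be a non-empty, $f$-compact and convex subset. If $T:K\to K$ is $f$-non-expansive and $f$-convergence implies $b$-convergence, then $T$ has a fixed point.
   Context: An asymmetric norm on a real vector space $X$ is a function $\Vert\cdot\vert:X\to\mathbb{R}$ such that for all $x,y\in X$ and $\lambda\ge 0$: $\Vert x\vert\ge 0$; $\Vert x\vert=\Vert -x\vert=0$ if and only if $x=0$; $\Vert\lambda x\vert=\lambda\Vert x\vert$; $\Vert x+y\vert\le\Vert x\vert+\Vert y\vert$. The pair $(X,\Vert\cdot\vert)$ is an asymmetric normed space, equipped with the asymmetric distance $d(x,y)=\Vert y-x\vert$ (in general $d(x,y)\ne d(y,x)$). The forward topology $\tau^f$ is generated by the base of balls $B^f(x,r)=\{u: d(x,u)<r\}$, $x\in X$, $r>0$. A subset $K$ is $f$-compact if every cover of $K$ by $\tau^f$-open sets has a finite subcover. A sequence $\{x_n\}$ $f$-converges to $x$ if $d(x,x_n)=\Vert x_n-x\vert\to 0$, and $b$-converges to $x$ if $d(x_n,x)=\Vert x-x_n\vert\to 0$. ''$f$-convergence implies $b$-convergence'' means that whenever $\{x_n\}$ $f$-converges to $x$, it also $b$-converges to $x$. A map $T:K\to K$ is $f$-non-expansive if $d(Tx,Ty)\le d(x,y)$, i.e. $\Vert Ty-Tx\vert\le\Vert y-x\vert$, for all $x,y\in K$. *)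

(* Defs.v *)
From HB Require Import structures.
From mathcomp Require Import all_boot all_order all_algebra.
From mathcomp Require Import all_classical all_reals all_analysis.
Set Implicit Arguments.
Unset Strict Implicit.
Unset Printing Implicit Defensive.
Import Order.TTheory GRing.Theory Num.Theory.
Import numFieldNormedType.Exports.
Local Open Scope classical_set_scope.
Local Open Scope ring_scope.

(* [anorm x] is the asymmetric norm; in general [anorm (- x) <> anorm x], and
   [anorm x = 0] alone does not force [x = 0]. *)
HB.mixin Record Lmodule_isAsymNormed (R : realType) X & GRing.Lmodule R X := {
  anorm : X -> R;
  anorm_ge0 : forall x, 0 <= anorm x;
  anorm_eq0 : forall x, (anorm x = 0 /\ anorm (- x) = 0) <-> x = 0;
  anormZ : forall (l : R) x, 0 <= l -> anorm (l *: x) = l * anorm x;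
  anormD : forall x y, anorm (x + y) <= anorm x + anorm y }.

#[short(type="asymNormedType")]
HB.structure Definition AsymNormedSpace (R : realType) :=
  {X of GRing.Lmodule R X & Lmodule_isAsymNormed R X}.

Definition adist (R : realType) (X : asymNormedType R) (x y : X) : R :=
  anorm (y - x).

Definition fball (R : realType) (X : asymNormedType R) (x : X) (r : R) : set X :=
  [set u | adist x u < r].

Definition fbase (R : realType) (X : asymNormedType R) : set (set X) :=
  [set B | exists x r, 0 < r /\ B = fball x r].

(* X itself gets no topology; this alias carries the forward one, so that [open]
   and [cover_compact] at [forward X] refer to unions of forward balls. *)
Definition forward (R : realType) (X : asymNormedType R) : Type := X.

HB.instance Definition _ (R : realType) (X : asymNormedType R) :=
  GRing.Lmodule.on (forward X).

Section forward_topology.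
Context (R : realType) (X : asymNormedType R).

Lemma adistxx (x : X) : adist x x = 0.
Proof. by rewrite /adist subrr; have [] := (anorm_eq0 (0 : X)).2 erefl. Qed.

Lemma adist_triangle (y x z : X) : adist x z <= adist x y + adist y z.
Proof.
by rewrite /adist -[z - x](subrKA y) addrC (le_trans (anormD _ _))// addrC.
Qed.

Lemma fbase_cover :
  \bigcup_(B in @fbase R X) (idfun B : set (forward X)) = setT.
Proof.
rewrite -subTset => x _; exists (fball (x : X) 1); first by exists x, 1.
by rewrite /= /fball /= adistxx.
Qed.

Lemma fbase_join (A B : set (forward X)) (t : forward X) :
  fbase A -> fbase B -> idfun A t -> idfun B t ->
  exists C : set (forward X),
    [/\ fbase C, idfun C t & idfun C `<=` idfun A `&` idfun B].
Proof.
move=> [x [r [r0 ->]]] [y [s [s0 ->]]]; rewrite /fball /= => xtr yts.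
exists (fball (t : X) (Num.min (r - adist (x : X) t) (s - adist (y : X) t))).
split => //=.
- exists t; eexists; split; last reflexivity.
  by rewrite lt_min !subr_gt0 xtr yts.
- by rewrite /fball /= adistxx lt_min !subr_gt0 xtr yts.
move=> u; rewrite /fball /= lt_min !ltrBrDl => /andP[xu yu].
by split; apply: le_lt_trans (adist_triangle t _ _) _.
Qed.

HB.instance Definition _ :=
  @isBaseTopological.Build (forward X) (set (forward X)) (@fbase R X) idfun
    fbase_cover fbase_join.

End forward_topology.

Definition fcompact (R : realType) (X : asymNormedType R) (K : set X) : Prop :=
  cover_compact (K : set (forward X)).

Definition fcvg (R : realType) (X : asymNormedType R) (u : nat -> X) (x : X) :=
  adist x (u n) @[n --> \oo] --> (0 : R).

Definition bcvg (R : realType) (X : asymNormedType R) (u : nat -> X) (x : X) :=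
  adist (u n) x @[n --> \oo] --> (0 : R).

Definition fnonexpansive (R : realType) (X : asymNormedType R) (K : set X)
    (T : X -> X) :=
  forall x y, K x -> K y -> adist (T x) (T y) <= adist x y.

(* Main.v *)
Require Import Defs.
From HB Require Import structures.
From mathcomp Require Import all_boot all_order all_algebra.
From mathcomp Require Import all_classical all_reals all_analysis.
From mathcomp Require Import lra.
Set Implicit Arguments.
Unset Strict Implicit.
Unset Printing Implicit Defensive.
Import Order.TTheory GRing.Theory Num.Theory.
Import numFieldNormedType.Exports.
Local Open Scope classical_set_scope.
Local Open Scope ring_scope.

(** The displacement [adist x (T x)] has infimum zero on [K]
    ([nonexpansive_displacement]): a compact set is bounded, and contracting
    [T] slightly towards a point [p] of [K], as convexity permits, yields a
    strict contraction of [K] along whose orbits the displacement tends to zero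
    ([contraction_displacement]).

    The comparison of forward and backward convergence upgrades by homogeneity
    to a linear bound [anorm (- x) <= C * anorm x] ([anormN_bounded]). It has
    two consequences: [adist x y = 0] alone forces [x = y], and a forward-small
    move of [x] changes the displacement of [T] by little. Hence, if [T] had no
    fixed point, the inverse of the displacement would be finite and locally
    bounded on [K], and so bounded by compactness
    ([fcompact_bounded_above]): the displacement would stay away from zero. *)

Lemma adist_ge0 (R : realType) (X : asymNormedType R) (x y : X) :
  0 <= adist x y.
Proof. exact: anorm_ge0. Qed.

Lemma open_fball (R : realType) (X : asymNormedType R) (x : X) (r : R) :
  0 < r -> open (fball x r : set (forward X)).
Proof.
move=> r0; exists [set (fball x r : set (forward X))].
  by move=> _ ->; exists x, r.
by rewrite bigcup_set1.
Qed.

(** If no [C] worked, vectors with [anorm (- x)] more than [n.+1] times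
    [anorm x], rescaled so that [anorm (- x) = 1], would converge forward to [0]
    while staying at backward distance [1] from it. *)
Lemma anormN_bounded (R : realType) (X : asymNormedType R)
    (f_b : forall (u : nat -> X) (x : X), fcvg u x -> bcvg u x) :
  exists2 C : R, 0 <= C & forall x : X, anorm (- x) <= C * anorm x.
Proof.
apply: contrapT => noC.
have large n : exists x : X, n.+1%:R * anorm x < anorm (- x).
  apply: contrapT => /forallNP nx; apply: noC; exists n.+1%:R => // x.
  by rewrite leNgt; apply/negP/nx.
have [u uP] := choice large.
have N0 n : 0 < anorm (- u n).
  by apply: le_lt_trans (uP n); rewrite mulr_ge0// anorm_ge0.
pose v n := (anorm (- u n))^-1 *: u n.
have vE n : anorm (- v n) = 1.
  by rewrite -scalerN anormZ ?invr_ge0 ?anorm_ge0// mulVf// gt_eqF.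
have /f_b : fcvg v 0.
  apply: (squeeze_cvgr _ (cvg_cst 0) (@cvg_harmonic R)).
  apply: nearW => n; rewrite adist_ge0/= /adist subr0.
  rewrite anormZ ?invr_ge0 ?anorm_ge0// mulrC ler_pdivrMr//.
  by rewrite mulrC ler_pdivlMr// mulrC ltW.
have dv0 : (fun n => adist (v n) 0) = cst 1.
  by apply/funext => n; rewrite /adist sub0r.
rewrite /bcvg dv0 => /(cvg_lim (@Rhausdorff R)).
by rewrite lim_cst// => /eqP; rewrite oner_eq0.
Qed.

(** The open sets [U n], unions of the balls on which [h <= n], cover [K]; indexing
    the cover by the bound itself makes the largest index of a finite subcover
    a bound on all of [K]. *)
Lemma fcompact_bounded_above (R : realType) (X : asymNormedType R) (K : set X)
    (h : X -> R) (K_compact : fcompact K)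
    (h_loc : forall x, K x -> exists r M, 0 < r /\
       forall y, K y -> adist x y < r -> h y <= M) :
  exists M, forall x, K x -> h x <= M.
Proof.
pose F (n : nat) := [set z : X * R | 0 < z.2 /\
  forall y, K y -> fball z.1 z.2 y -> h y <= n%:R].
pose U n : set (forward X) := \bigcup_(z in F n) fball z.1 z.2.
have [||D _ KD] := K_compact nat setT U.
- by move=> n _; apply: bigcup_open => z [z0 _]; exact: open_fball.
- move=> x Kx; have [r [M [r0 hM]]] := h_loc x Kx.
  exists (Num.truncn M).+1 => //; exists (x, r).
    split=> // y Ky /hM-/(_ Ky)/le_trans; apply.
    exact/ltW/truncnS_gt.
  by rewrite /fball/= adistxx.
exists (\max_(i <- finmap.enum_fset D) i)%N%:R => x Kx.
have [n /= nD [z [_ hz] xz]] := KD x Kx.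
by rewrite (le_trans (hz _ Kx xz))// ler_nat leq_bigmax_seq.
Qed.

(** Along an orbit of [S] the displacement decays geometrically, so a late
    enough point of the orbit will do. *)
Lemma contraction_displacement (R : realType) (X : asymNormedType R)
    (K : set X) (S : X -> X) (c e : R) :
  K !=set0 -> set_fun K K S -> 0 <= c -> c < 1 ->
  (forall x y, K x -> K y -> adist (S x) (S y) <= c * adist x y) ->
  0 < e -> exists2 x, K x & adist x (S x) < e.
Proof.
move=> [p Kp] SK c0 c1 Sc e0.
have Kn n : K (iter n S p) by elim: n => [|n /SK].
have dn n : adist (iter n S p) (S (iter n S p)) <= c ^+ n * adist p (S p).
  elim: n => [|n IH]; first by rewrite expr0 mul1r.
  rewrite exprS -mulrA; apply: le_trans (ler_wpM2l c0 IH).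
  by apply: (Sc _ _ (Kn n) (Kn n.+1)).
have cn0 : c ^+ n * adist p (S p) @[n --> \oo] --> (0 : R).
  rewrite -(mul0r (adist p (S p))); apply: cvgMr_tmp.
  by apply: cvg_expr; rewrite ger0_norm.
have [n _ /(_ n (leqnn n)) cne] := cvgr_lt (0 : R) cn0 e e0.
by exists (iter n S p) => //; exact: le_lt_trans (dn n) cne.
Qed.

(** The averaged map [S x = t *: p + (1 - t) *: T x] is a [1 - t]-contraction
    of [K] and satisfies [adist (S x) (T x) = t * adist p (T x) <= t * M]. Points
    that [S] moves by less than [e / 2] are therefore moved by less than [e] by
    [T], as soon as [t * M <= e / 2]. *)
Lemma nonexpansive_displacement (R : realType) (X : asymNormedType R)
    (K : set X) (T : X -> X) (M e : R) (p : X) (Kp : K p)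
    (K_bounded : forall x, K x -> adist p x <= M)
    (K_convex : convex_set (K : set (convex_lmodType X)))
    (TK : set_fun K K T) (T_nonexp : fnonexpansive K T) (e0 : 0 < e) :
  exists2 x, K x & adist x (T x) < e.
Proof.
have M0 : 0 <= M by rewrite (le_trans _ (K_bounded p Kp))// adist_ge0.
have eM : 0 < e + M by rewrite ltr_wpDr.
(* Adding [e] to the denominator makes [t < 1] and covers the case [M = 0]. *)
pose t := e / 2 / (e + M).
have t0 : 0 < t by rewrite !divr_gt0.
have tM : t * M <= e / 2.
  rewrite -mulrA ler_piMr//; first by rewrite divr_ge0// ltW.
  by rewrite mulrC ler_pdivrMr// mul1r lerDr ltW.
have t1 : t < 1 by rewrite ltr_pdivrMr// mul1r; lra.
pose S x := t *: p + (1 - t) *: T x.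
have SK : set_fun K K S.
  move=> x Kx.
  have := K_convex p (T x) (Itv01 (ltW t0) (ltW t1)).
  by rewrite !inE; apply => //; exact: TK.
have Sc x y : K x -> K y -> adist (S x) (S y) <= (1 - t) * adist x y.
  move=> Kx Ky; rewrite /adist /S opprD addrACA subrr add0r -scalerBr.
  rewrite anormZ; last by rewrite subr_ge0 ltW.
  by rewrite ler_pM2l ?subr_gt0//; exact: T_nonexp.
have [||||x Kx xe] :=
  @contraction_displacement _ _ K S (1 - t) (e / 2) _ SK _ _ Sc.
- by exists p.
- by rewrite subr_ge0 ltW.
- by rewrite ltrBlDr ltrDl.
- by rewrite divr_gt0.
exists x => //; apply: le_lt_trans (adist_triangle (S x) _ _) _.
have -> : adist (S x) (T x) = t * adist p (T x).
  rewrite /adist -anormZ; last exact: ltW.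
  congr anorm.
  by rewrite /S scalerBl scale1r scalerBr opprD opprB addrCA subrKC addrC.
have : t * adist p (T x) <= t * M by rewrite ler_pM2l//; apply/K_bounded/TK.
lra.
Qed.

Theorem theorem22 (R : realType) (X : asymNormedType R) (K : set X)
    (K_neq0 : K !=set0) (K_compact : fcompact K)
    (K_convex : convex_set (K : set (convex_lmodType X)))
    (T : X -> X) (TK : set_fun K K T) (T_nonexp : fnonexpansive K T)
    (f_b : forall (u : nat -> X) (x : X), fcvg u x -> bcvg u x) :
  exists2 x, K x & T x = x.
Proof.
have [C C0 CP] := anormN_bounded f_b.
have [p Kp] := K_neq0.
have [M KM] : exists M, forall x, K x -> adist p x <= M.
  apply: fcompact_bounded_above => // x Kx; exists 1, (adist p x + 1).
  by split=> // y _ /ltW xy; rewrite (le_trans (adist_triangle x _ _))// lerD2l.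
apply: contrapT => noFix.
have g0 x : K x -> 0 < adist x (T x).
  move=> Kx; rewrite lt_neqAle adist_ge0 andbT eq_sym.
  apply: contra_notN noFix => /eqP d0; exists x => //.
  apply/eqP; rewrite -subr_eq0; apply/eqP/anorm_eq0; split=> //.
  apply/eqP; rewrite eq_le anorm_ge0 andbT (le_trans (CP _))//.
  by move: d0; rewrite /adist => ->; rewrite mulr0.
have [N KN] : exists N, forall x, K x -> (adist x (T x))^-1 <= N.
  apply: fcompact_bounded_above => // x Kx.
  set g := adist x (T x).
  have gx : 0 < g := g0 x Kx.
  exists (g / 2 / (1 + C)), (g / 2)^-1.
  split; first by rewrite !divr_gt0// ltr_pwDl.
  move=> y Ky; rewrite ltr_pdivlMr ?ltr_pwDl// => xy.
  rewrite lef_pV2 ?posrE ?divr_gt0 ?g0//.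
  (* [g <= adist x y + adist y (T y) + adist (T y) (T x)]: nonexpansiveness
     bounds the last term by [adist y x], whose arguments are in the wrong order
     for the forward ball; it is at most [C * adist x y]. The outer terms thus
     add up to [(1 + C) * adist x y < g / 2], which dictates the radius. *)
  have T1 := adist_triangle y x (T x).
  have T2 := adist_triangle (T y) y (T x).
  have T3 := T_nonexp y x Ky Kx.
  have T4 : adist y x <= C * adist x y.
    by rewrite /adist -[x - y]opprB; exact: CP.
  rewrite -/g in T1; lra.
have N0 : 0 < N by rewrite (lt_le_trans _ (KN p Kp))// invr_gt0 g0.
have [|x Kx] :=
  @nonexpansive_displacement _ _ K T M N^-1 p Kp KM K_convex TK T_nonexp.
  by rewrite invr_gt0.
by rewrite -ltf_pV2 ?posrE ?invr_gt0 ?g0// invrK ltNge KN.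
Qed.
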